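(* Let $\alpha,\beta,\gamma$ be positive irrational real numbers with $\alpha+\beta+\gamma=1$, and suppose that $\alpha>1/3$ and that $1,\alpha,\beta$ are linearly independent over $\mathbb{Q}$. Then there is no partition $\mathbb{N}=B_\alpha\cup\widetilde{B_\beta}\cup\widetilde{B_\gamma}$, where $B_\alpha=\{\lfloor n/\alpha\rfloor:n\in\mathbb{N}\}$ and $\widetilde{B_\beta}=\{\widetilde{b}(n)\}$, $\widetilde{B_\gamma}=\{\widetilde{c}(n)\}$ are almost Beatty sequences of densities $\beta$ and $\gamma$ respectively, such that $\|\widetilde{b}-b\|\le 1$ and $\|\widetilde{c}-c\|\le 1$, where $b(n)=\lfloor n/\beta\rfloor$ and $c(n)=\lfloor n/\gamma\rfloor$.
   Context: $\mathbb{N}=\{1,2,3,\dots\}$. Subsets of $\mathbb{N}$ are identified with strictly increasing sequences (their elements in increasing order), and a partition of $\mathbb{N}$ is a collection of subsets such that every positive integer lies in exactly one of them. For sequences $a,b$ indexed by $\mathbb{N}$, $\|a-b\|=\sup\{|a(n)-b(n)|:n\in\mathbb{N}\}$. An almost Beatty sequence of density $\theta\in(0,1)$ is a strictly increasing sequence $(\widetilde{a}(n))_{n\in\mathbb{N}}$ of positive integers with $\sup_n|\widetilde{a}(n)-\lfloor n/\theta\rfloor|<\infty$. *)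

(* Defs.v *)
From mathcomp Require Export all_boot all_order all_algebra.
From mathcomp Require Export all_classical all_reals ereal.

Set Implicit Arguments.
Unset Strict Implicit.
Unset Printing Implicit Defensive.

Import Order.TTheory GRing.Theory Num.Theory.
Local Open Scope classical_set_scope.
Local Open Scope ring_scope.

(** Sequences indexed by {1, 2, 3, ...} are functions [nat -> int] of which only
    the values at positive arguments matter: indices always range over
    [pos_index], so the value at [0] is junk. *)
Definition pos_index : set nat := [set n | (0 < n)%N].

Definition pos_int : set int := [set m | 0 < m].

Definition seq_range (a : nat -> int) : set int := [set a n | n in pos_index].

Definition beatty (R : realType) (theta : R) (n : nat) : int :=
  Num.floor (n%:R / theta).

(** [sup_n |a n - b n|], with value [+oo] for an unbounded difference. *)
Definition seq_dist (R : realType) (a b : nat -> int) : \bar R :=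
  ereal_sup [set (`|a n - b n|%:~R)%:E | n in pos_index].

Definition almost_beatty (R : realType) (theta : R) (a : nat -> int) : Prop :=
  [/\ 0 < theta < 1,
      forall n, pos_index n -> pos_int (a n),
      forall m n, pos_index m -> pos_index n -> (m < n)%N -> a m < a n
    & (seq_dist R a (beatty theta) < +oo)%E].

Definition rat_lin_indep (R : realType) (n : nat) (v : n.-tuple R) : Prop :=
  forall q : 'I_n -> rat,
    \sum_(i < n) ratr (q i) * tnth v i = 0 -> forall i, q i = 0.

(** [partition] also asks the parts to be nonempty; this is automatic when they
    are ranges of sequences. *)
Definition pos_partition3 (A B C : set int) : Prop :=
  partition [set: 'I_3] (tnth [tuple A; B; C]) pos_int.

(* Main.v *)
(** Put [N = m + 1] and let [u], [v], [w] be the fractional parts of [N alpha],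
    [N beta], [N gamma], so that [u + v + w] is [1] or [2].  A perturbed sequence
    at distance at most [1] from the Beatty sequence of density [theta] has at
    most [floor ((N + 1) theta)] terms in [[1, m]], and this is
    [floor (N theta)] as soon as the fractional part of [N theta] is below
    [1 - theta].  If moreover [u + v + w = 2], the three sequences together have
    at most [N - 2 = m - 1] terms in [[1, m]] and cannot cover it.  The conditions
    [v < 1 - beta], [w < 1 - gamma], [u + v + w = 2] describe a region of the unit
    square with nonempty interior, because [(1 - beta) + (1 - gamma) = 1 + alpha];
    by Kronecker's theorem some [(u, v)] lies in it. *)

Require Import Defs.
From mathcomp Require Import zify ring lra.
Import Order.TTheory GRing.Theory Num.Theory.
Local Open Scope classical_set_scope.
Local Open Scope ring_scope.

(** Pigeonhole: among [(K+1)^2 + 1] multiples of [(x, y)] modulo 1, two lie in the same box of side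
    [1/(K+1) < d]; the difference of their indices is [q]. *)
Lemma dirichlet2 (R : realType) (x y d : R) : 0 < d ->
  exists q : nat, exists p r : int,
    [/\ (0 < q)%N, `|q%:R * x - p%:~R| < d & `|q%:R * y - r%:~R| < d].
Proof.
move=> d0.
pose K := Num.truncn d^-1.
have Kd : d^-1 < K.+1%:R by exact: truncnS_gt.
have K0 : 0 < K.+1%:R :> R by rewrite ltr0n.
have Kd1 : 1 < K.+1%:R * d by rewrite -ltr_pdivrMr// div1r.
pose fr (z : R) := z - (Num.floor z)%:~R.
have frP z : 0 <= fr z < 1.
  by rewrite /fr; have := floor_le z; have := floorD1_gt z; rewrite intrD; lra.
pose box (z : R) : 'I_K.+1 := inord (Num.truncn (K.+1%:R * fr z)).
have boxP z : (box z)%:R <= K.+1%:R * fr z < (box z)%:R + 1.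
  have /andP[z0 z1] := frP z.
  have Kz : 0 <= K.+1%:R * fr z by rewrite mulr_ge0// ltW.
  have /andP[t1 t2] := truncn_itv Kz.
  rewrite /box inordK; first by rewrite natr1 t1 t2.
  by rewrite -(ltr_nat R); apply: le_lt_trans t1 _; rewrite gtr_pMr.
have close z z' : box z = box z' -> `|fr z - fr z'| < d.
  move=> e; have := boxP z; have := boxP z'; rewrite e => /andP[h1 h2] /andP[h3 h4].
  rewrite -(ltr_pM2l K0) -{1}(gtr0_norm K0) -normrM mulrBr.
  by apply: lt_trans Kd1; rewrite ltr_norml; lra.
pose f (n : 'I_(K.+1 * K.+1).+1) := (box (n%:R * x), box (n%:R * y)).
have /injectivePn[n [n' nn' ff']] : ~~ injectiveb f.
  apply/injectiveP => /leq_card; rewrite card_prod !card_ord; lia.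
wlog lt_nn' : n n' nn' ff' / (n < n')%N.
  move=> W; case: (ltngtP n n') => [|/W|/val_inj E]; first exact: W.
    by rewrite eq_sym nn' ff'; exact.
  by rewrite E eqxx in nn'.
case: ff' => /close Ex /close Ey.
exists (n' - n)%N, (Num.floor (n'%:R * x) - Num.floor (n%:R * x)),
  (Num.floor (n'%:R * y) - Num.floor (n%:R * y)).
rewrite subn_gt0; split=> //; rewrite natrB ?(ltnW lt_nn')// distrC.
  by move: Ex; rewrite /fr !rmorphB/=; congr (`|_| < d); ring.
by move: Ey; rewrite /fr !rmorphB/=; congr (`|_| < d); ring.
Qed.

Lemma rat_lin_indep3_int (R : realType) (x y : R) (p q r : int) :
  rat_lin_indep [tuple 1; x; y] ->
  p%:~R + q%:~R * x + r%:~R * y = 0 -> [/\ p = 0, q = 0 & r = 0].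
Proof.
move=> indep e.
pose c (i : 'I_3) : rat := (tnth [tuple p; q; r] i)%:~R.
have /indep c0 : \sum_(i < 3) ratr (c i) * tnth [tuple 1; x; y] i = 0.
  by rewrite !big_ord_recl big_ord0 /c !ratr_int !(tnth_nth 0)/= mulr1 addr0 addrA.
have ci i : tnth [tuple p; q; r] i = 0.
  by apply/eqP; rewrite -(intr_eq0 rat); apply/eqP; exact: c0.
split; [have := ci 0 | have := ci 1 | have := ci 2%:R]; by rewrite (tnth_nth 0).
Qed.

(** Two small multiples [(a1, b1)] and [(a2, b2)] of [(x, y)] modulo integers form a basis of the
    plane. Some integer translate of [(s, t)] has large positive coordinates in it; truncating these
    to [k] and [l] costs less than [d], and [N = k q1 + l q2]. *)
Lemma kronecker2 (R : realType) (x y s t d : R) (N0 : nat) :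
  rat_lin_indep [tuple 1; x; y] -> 0 < d ->
  exists N : nat, exists p r : int,
    [/\ (N0 < N)%N, `|N%:R * x - p%:~R - s| < d & `|N%:R * y - r%:~R - t| < d].
Proof.
move=> indep d0.
have [q1 [p1 [r1 []]]] := @dirichlet2 R x y (d / 2) ltac:(lra).
set a1 := _ - _; set b1 := q1%:R * y - _ => q10 a1d b1d.
have q1R : 0 < q1%:R :> R by rewrite ltr0n.
have a10 : a1 != 0.
  apply/eqP => a10.
  have [|_ + _] := @rat_lin_indep3_int R x y (- p1) q1 0 indep; last by lia.
  by rewrite mul0r addr0 -[RHS]a10 /a1 rmorphN/= addrC.
pose d2 := Num.min (d / 2) (`|a1| / q1%:R).
have d20 : 0 < d2.
  by rewrite lt_min divr_gt0//= divr_gt0// normr_gt0.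
have [q2 [p2 [r2 []]]] := @dirichlet2 R x y d2 d20.
set a2 := _ - _; set b2 := q2%:R * y - _ => q20.
rewrite !lt_min => /andP[a2d a2a1] /andP[b2d _].
(* The [x * y] terms of [D] cancel, so [D = 0] is an integral relation between
   [1], [x] and [y]: it forces the two approximations to be proportional, and
   then [|a2| >= |a1| / q1]. *)
pose D := a1 * b2 - a2 * b1.
have D0 : D != 0.
  apply/eqP => D0.
  have [||_ _ e] := @rat_lin_indep3_int R x y
    (p1 * r2 - p2 * r1) (q2%:Z * r1 - q1%:Z * r2) (p2 * q1%:Z - p1 * q2%:Z) => //.
    rewrite -[RHS]D0 /D /a1 /a2 /b1 /b2 !(rmorphB, rmorphM)/=.
    by rewrite -!pmulrn; ring.
  have e' : p2%:~R * q1%:R = p1%:~R * q2%:R :> R.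
    have := congr1 (fun z : int => z%:~R : R) e.
    by rewrite rmorphB !rmorphM/= -!pmulrn => /eqP; rewrite subr_eq0 => /eqP.
  have e2 : a2 * q1%:R = a1 * q2%:R by rewrite /a1 /a2 !mulrBl e'; ring.
  move: a2a1; rewrite ltr_pdivlMr// -{1}(gtr0_norm q1R) -normrM e2 normrM normr_nat.
  by rewrite ltNge ler_peMr// ler1n.
pose C := (1 + `|s| + (1 + `|t|)) * ((`|a1| + `|b1| + `|a2| + `|b2|) / `|D|).
pose M := (Num.truncn C + N0).+2.
have MC : C + N0%:R + 1 <= M%:R.
  have := truncnS_gt C; rewrite /M -addnS -addSn natrD -[N0.+1%:R]natr1; lra.
(* Adding the integers [P], [S] to the target is free. As they round [M] times the sum of the basis
   vectors, both coordinates of the new target are within [C] of [M], hence at least [N0 + 1]. *)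
pose P := Num.floor (M%:R * (a1 + a2)).
pose S := Num.floor (M%:R * (b1 + b2)).
pose e1 := s + P%:~R - M%:R * (a1 + a2).
pose e2 := t + S%:~R - M%:R * (b1 + b2).
have e1_le : `|e1| <= 1 + `|s|.
  rewrite /e1 -addrA addrC (le_trans (ler_normD _ _))// lerD2r ler_norml.
  have := floor_le (M%:R * (a1 + a2)); have := floorD1_gt (M%:R * (a1 + a2)).
  by rewrite intrD -/P; lra.
have e2_le : `|e2| <= 1 + `|t|.
  rewrite /e2 -addrA addrC (le_trans (ler_normD _ _))// lerD2r ler_norml.
  have := floor_le (M%:R * (b1 + b2)); have := floorD1_gt (M%:R * (b1 + b2)).
  by rewrite intrD -/S; lra.
have coeff g h : `|g| <= `|a1| + `|b1| + `|a2| + `|b2| ->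
    `|h| <= `|a1| + `|b1| + `|a2| + `|b2| ->
    N0%:R + 1 <= M%:R + (e1 * g + e2 * h) / D.
  move=> gle hle; apply: le_trans (_ : M%:R - C <= _); first by lra.
  rewrite lerD2l lerNl; apply: le_trans (ler_norm _) _.
  rewrite normrN normrM normfV /C mulrA ler_pM2r ?invr_gt0 ?normr_gt0//.
  rewrite [leRHS]mulrDl (le_trans (ler_normD _ _))// !normrM lerD//; exact: ler_pM.
(* Cramer's rule for the coordinates of [(s + P, t + S)]. *)
pose a := M%:R + (e1 * b2 + e2 * - a2) / D.
pose b := M%:R + (e1 * - b1 + e2 * a1) / D.
have := normr_ge0 a1; have := normr_ge0 a2.
have := normr_ge0 b1; have := normr_ge0 b2 => b20 b10 a20 a1n0.
have a_ge : N0%:R + 1 <= a by apply: coeff; rewrite ?normrN; lra.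
have b_ge : N0%:R + 1 <= b by apply: coeff; rewrite ?normrN; lra.
have N00 : 0 <= N0%:R :> R by [].
have /truncn_itv := le_trans (ltac:(lra) : 0 <= N0%:R + 1 :> R) a_ge.
have /truncn_itv := le_trans (ltac:(lra) : 0 <= N0%:R + 1 :> R) b_ge.
set l := Num.truncn b; set k := Num.truncn a => /andP[lb bl] /andP[ka ak].
have kN0 : (N0 < k)%N.
  by have := le_lt_trans a_ge ak; rewrite natr1 ltr_nat.
rewrite -natr1 in bl; rewrite -natr1 in ak.
have ab1 : a * a1 + b * a2 = s + P%:~R.
  by rewrite /a /b /e1 /e2 /D in D0 *; field.
have ab2 : a * b1 + b * b2 = t + S%:~R.
  by rewrite /a /b /e1 /e2 /D in D0 *; field.
have near (c1 c2 : R) : `|c1| < d / 2 -> `|c2| < d / 2 ->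
    `|k%:R * c1 + l%:R * c2 - (a * c1 + b * c2)| < d.
  move=> c1d c2d.
  rewrite (_ : _ - _ = (k%:R - a) * c1 + (l%:R - b) * c2); last by ring.
  apply: le_lt_trans (ler_normD _ _) _; rewrite !normrM.
  have k1 : `|k%:R - a| <= 1 by rewrite ler_norml; lra.
  have l1 : `|l%:R - b| <= 1 by rewrite ler_norml; lra.
  have := ler_piMl (normr_ge0 c1) k1; have := ler_piMl (normr_ge0 c2) l1; lra.
exists (k * q1 + l * q2)%N, (k%:Z * p1 + l%:Z * p2 + P), (k%:Z * r1 + l%:Z * r2 + S).
split.
- by rewrite ltn_addr// (leq_trans kN0)// leq_pmulr.
- have := near _ _ a1d a2d; rewrite ab1; congr (`|_| < d).
  by rewrite /a1 /a2 !(rmorphD, rmorphM)/= -!pmulrn ?(natrD, natrM); ring.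
- have := near _ _ b1d b2d; rewrite ab2; congr (`|_| < d).
  by rewrite /b1 /b2 !(rmorphD, rmorphM)/= -!pmulrn ?(natrD, natrM); ring.
Qed.

Lemma seq_dist_le1 (R : realType) (a b : nat -> int) (n : nat) :
  (seq_dist R a b <= 1)%E -> pos_index n -> `|a n - b n| <= 1.
Proof.
move=> ab n0; rewrite -(ler_int R) -lee_fin; apply: le_trans ab.
by apply: ereal_sup_ubound; exists n.
Qed.

(** For integer [m], [floor (n / theta) <= m] means [n < (m + 1) * theta]. *)
Lemma beatty_le_index (R : realType) (theta : R) (n : nat) (m k : int) :
  0 < theta -> (m + 1)%:~R * theta < (k + 1)%:~R ->
  beatty theta n <= m -> n%:Z <= k.
Proof.
move=> th0 mk nm; rewrite -ltzD1 -(ltr_int R); apply: lt_trans mk.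
by rewrite -ltr_pdivrMr// -floor_lt_int ltzD1.
Qed.

Lemma cover_pos_int_le (a b c : nat -> int) (m p r s : nat) :
  (forall k : int, 0 < k <= m%:Z ->
     exists n, (0 < n)%N /\ [\/ a n = k /\ (n <= p)%N, b n = k /\ (n <= r)%N
                              | c n = k /\ (n <= s)%N]) ->
  (m <= p + r + s)%N.
Proof.
move=> cov.
pose im (f : nat -> int) j := [seq f n | n <- iota 1 j].
rewrite -(size_iota 1 m) -(size_map Posz).
have -> : (p + r + s)%N = size (im a p ++ im b r ++ im c s).
  by rewrite !size_cat !size_map !size_iota addnA.
apply: uniq_leq_size; first by rewrite map_inj_uniq ?iota_uniq// => ? ? [].
move=> _ /mapP[j + ->]; rewrite mem_iota => jm.
have [|n [n0 h]] := cov j%:Z; first by lia.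
have mem (f : nat -> int) i : f n = j%:Z -> (n <= i)%N -> j%:Z \in im f i.
  by move=> <- ni; apply: map_f; rewrite mem_iota n0 add1n ltnS.
by rewrite !mem_cat; case: h => [] [/mem h /h ->]; rewrite ?orbT.
Qed.

Theorem theorem8 (R : realType) (alpha beta gamma : R)
    (alpha_gt0 : 0 < alpha) (beta_gt0 : 0 < beta) (gamma_gt0 : 0 < gamma)
    (alpha_irr : irrational alpha) (beta_irr : irrational beta)
    (gamma_irr : irrational gamma)
    (sum1 : alpha + beta + gamma = 1)
    (alpha_gt : 1 / 3 < alpha)
    (indep : rat_lin_indep [tuple 1; alpha; beta]) :
  ~ exists b c : nat -> int,
      [/\ almost_beatty beta b,
          almost_beatty gamma c,
          (seq_dist R b (beatty beta) <= 1)%E,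
          (seq_dist R c (beatty gamma) <= 1)%E
        & pos_partition3 (seq_range (beatty alpha)) (seq_range b) (seq_range c)].
Proof.
case=> b [c [_ _ db dc [cov _ _]]].
(* This target and tolerance give [1 - alpha/4 < u < 1] and [v] within [alpha/8] of
   [gamma + alpha/2], hence [v < 1 - beta]. Then [2 - u - v] is within [alpha/4] of
   [1 - gamma - 3 alpha/8], so it lies between [0] and [1 - gamma]. *)
have [N [p [r [N1 up vr]]]] := @kronecker2 R alpha beta (1 - alpha / 8)
  (gamma + alpha / 2) (alpha / 8) 1 indep ltac:(lra).
(* With [w = 2 - u - v], this is the floor of [N gamma]. *)
pose s : int := N%:Z - p - r - 2.
have sE : s%:~R = N%:R - p%:~R - r%:~R - 2 :> R by rewrite /s !rmorphB/= -pmulrn.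
have gE : gamma = 1 - alpha - beta by lra.
have NgE : N%:R * gamma = N%:R - N%:R * alpha - N%:R * beta by rewrite gE; ring.
rewrite ltr_norml in up; rewrite ltr_norml in vr.
have N0R : 0 < N%:R :> R by rewrite ltr0n ltnW.
have := mulr_gt0 N0R alpha_gt0; have := mulr_gt0 N0R beta_gt0.
have := mulr_gt0 N0R gamma_gt0 => Ng Nb Na.
have p0 : 0 <= p by rewrite -ltzD1 -(ltr_int R) intrD; lra.
have r0 : 0 <= r by rewrite -ltzD1 -(ltr_int R) intrD; lra.
have s0 : 0 <= s by rewrite -ltzD1 -(ltr_int R) intrD; lra.
(* The right side is [N - 2]. *)
suff : (N.-1 <= `|p| + `|r| + `|s|)%N by clear -N1 p0 r0 s0; lia.
apply: (@cover_pos_int_le (beatty alpha) b c) => k k_itv.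
have NE : N.-1%:Z + 1 = N%:Z by clear -N1; lia.
have : pos_int k by case/andP: k_itv.
rewrite -cov => -[[[|[|[|//]]] i3] _]; rewrite (tnth_nth set0)/= => -[n n0 nk];
  exists n; (split; first exact: n0).
- constructor 1; split=> //.
  have : n%:Z <= p; last by clear -p0; lia.
  apply: (@beatty_le_index R alpha n N.-1%:Z) => //; last by case/andP: k_itv => _; rewrite nk.
  by rewrite NE intrD -pmulrn; lra.
- constructor 2; split=> //.
  have : n%:Z <= r; last by clear -r0; lia.
  (* The perturbation costs one: [b n <= N - 1] only gives [beatty beta n <= N], and
     [(N + 1) beta < r + 1] is the condition [v < 1 - beta]. *)
  apply: (@beatty_le_index R beta n N%:Z) => //.
    by rewrite !intrD -pmulrn mulrDl mul1r; lra.
  by have := seq_dist_le1 _ _ _ _ db n0; case/andP: k_itv => _; clear -nk NE; lia.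
- constructor 3; split=> //.
  have : n%:Z <= s; last by clear -s0; lia.
  apply: (@beatty_le_index R gamma n N%:Z) => //.
    by rewrite !intrD -pmulrn mulrDl mul1r; lra.
  by have := seq_dist_le1 _ _ _ _ dc n0; case/andP: k_itv => _; clear -nk NE; lia.
Qed.
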